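(* Let $J$ be a finite ground set and let $\mathscr{S}$ be a family of subsets of $J$ that is irredundant and covers $J$. Let $G^c_{\mathscr{S}}$ be its conflict graph. If $\{(A^j,B^j)\}_{j=1}^t$ is a biclique cover of the conflict graph $G^c_{\mathscr{S}}$ for pairwise IB-representable $\operatorname{CDC}(\mathscr{S})$, then a pairwise IB scheme for $\operatorname{CDC}(\mathscr{S})$ is given by $$L^j=J\setminus A^j,\qquad R^j=J\setminus B^j\qquad\forall j\in\{1,\ldots,t\}.$$ Conversely, if $\{(L^j,R^j)\}_{j=1}^t$ is a pairwise IB scheme for $\operatorname{CDC}(\mathscr{S})$, then a biclique cover of the conflict graph $G^c_{\mathscr{S}}$ is given by $$A^j=J\setminus L^j,\qquad B^j=J\setminus R^j\qquad\forall j\in\{1,\ldots,t\}.$$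
   Context: $\Delta^J=\{\lambda\in\mathbb{R}^J_{\ge 0}:\sum_{v\in J}\lambda_v=1\}$. For $S\subseteq J$, $Q(S)=\{\lambda\in\Delta^J:\lambda_v\le 0\ \forall v\in J\setminus S\}$, and $\operatorname{CDC}(\mathscr{S})=\bigcup_{S\in\mathscr{S}}Q(S)$. $\mathscr{S}$ is irredundant if there are no distinct $S,T\in\mathscr{S}$ with $S\subseteq T$; it covers $J$ if $\bigcup_{S\in\mathscr{S}}S=J$. A set $T\subseteq J$ is feasible if $T\subseteq S$ for some $S\in\mathscr{S}$, and infeasible otherwise. A pairwise IB (independent branching) scheme for $\operatorname{CDC}(\mathscr{S})$ is a family $\{(L^j,R^j)\}_{j=1}^t$ with $L^j,R^j\subseteq J$ and $\operatorname{CDC}(\mathscr{S})=\bigcap_{j=1}^t(Q(L^j)\cup Q(R^j))$. $\operatorname{CDC}(\mathscr{S})$ is pairwise IB-representable if it admits a pairwise IB scheme. The conflict graph is $G^c_{\mathscr{S}}=(J,\bar E)$, where $\bar E$ is the set of all infeasible two-element subsets $\{u,v\}\subseteq J$. A biclique cover of a graph $G=(J,E)$ is a collection of complete bipartite subgraphs of $G$, given by pairs $\{(A^j,B^j)\}_{j=1}^t$, that cover all edges of $G$; formally, for each $j$, $\emptyset\subsetneq A^j,B^j\subsetneq J$, $A^j\cap B^j=\emptyset$, and $\bigcup_{j=1}^t A^j*B^j=E$, where $A*B=\{\{a,b\}:a\in A,\ b\in B\}$.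
   Formalization: The converse fails if some L^j or R^j equals J (then A^j or B^j is empty); it is proved when no L^j or R^j equals J, and for every scheme after discarding the pairs with L^j = J or R^j = J. *)

(* Defs.v *)
From HB Require Import structures.
From mathcomp Require Import all_boot all_order all_algebra.
From mathcomp Require Import boolp classical_sets reals.

Set Implicit Arguments.
Unset Strict Implicit.
Unset Printing Implicit Defensive.

Import Order.TTheory GRing.Theory Num.Theory.

Local Open Scope ring_scope.
Local Open Scope classical_set_scope.

(* The ground set J is a finType; its subsets and the families of its subsets
   are finite sets ({set J}, {set {set J}}), while subsets of R^J are classical
   sets. classical_sets shadows some names of finset, hence the qualified
   finset.setT, finset.set0, finset.cover. *)

Section SetFamilies.
Context {J : finType}.
Implicit Types (F : {set {set J}}) (T : {set J}).

Definition irredundant F : Prop :=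
  forall S T, S \in F -> T \in F -> S <> T -> ~ (S \subset T).

Definition covers F : Prop := finset.cover F = [set: J]%SET.

Definition feasible F T : bool := [exists S in F, T \subset S].

(* A simple graph on J is given by its edge set, a set of two-element sets. *)
Definition conflict_graph F : {set {set J}} :=
  [set e : {set J} | (#|e| == 2)%N && ~~ feasible F e]%SET.

Definition bip_edges (A B : {set J}) : {set {set J}} :=
  [set [set a; b] | a in A, b in B]%SET.

(* Families are indexed by an arbitrary finite type I; {1, ..., t} is 'I_t. *)
Definition biclique_cover (E : {set {set J}}) {I : finType}
    (A B : I -> {set J}) : Prop :=
  (forall j, [/\ finset.set0 \proper A j, A j \proper finset.setT,
                 finset.set0 \proper B j, B j \proper finset.setT
               & (A j :&: B j = finset.set0)%SET])
  /\ (\bigcup_(j : I) bip_edges (A j) (B j))%SET = E.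

End SetFamilies.

Section Disjunctive.
Context (R : realType) {J : finType}.
Implicit Types (F : {set {set J}}) (l : {ffun J -> R}).

Definition simplex : set {ffun J -> R} :=
  [set l | (forall v, 0 <= l v) /\ \sum_v l v = 1].

Definition Q (S : {set J}) : set {ffun J -> R} :=
  [set l | simplex l /\ forall v, v \notin S -> l v <= 0].

Definition CDC F : set {ffun J -> R} := \bigcup_(S in [set` F]) Q S.

(* The intersection is taken inside the simplex, so that it is the simplex,
   rather than the whole of R^J, for the empty family (t = 0). For nonempty I
   the factor [simplex] is redundant. *)
Definition pairwise_IB_scheme F {I : finType} (L U : I -> {set J}) : Prop :=
  CDC F = simplex `&` \bigcap_j (Q (L j) `|` Q (U j)).

Definition pairwise_IB_representable F : Prop :=
  exists (t : nat) (L U : 'I_t -> {set J}), pairwise_IB_scheme F L U.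

End Disjunctive.

(* Main.v *)
(** The uniform distribution on a nonempty set T lies in Q(S) iff T is a subset
    of S, and a point of the simplex lies in Q(S) iff its support is a subset
    of S. Hence a pairwise IB scheme is the same thing as the combinatorial
    condition [pairwise_separation]: a nonempty T is feasible iff for every j
    it avoids the complement of L^j or that of R^j. The theorem compares this
    condition, for sets T of size 1 and 2, with the definition of a biclique
    cover; representability is what reduces infeasibility of an arbitrary set
    to infeasibility of a pair. *)
Require Import Defs.
From HB Require Import structures.
From mathcomp Require Import all_boot all_order all_algebra.
From mathcomp Require Import boolp classical_sets reals.

Set Implicit Arguments.
Unset Strict Implicit.
Unset Printing Implicit Defensive.

Import Order.TTheory GRing.Theory Num.Theory.

Section SupportSets.
Variables (R : realType) (J : finType).
Implicit Types (F : {set {set J}}) (S T : {set J}) (l : {ffun J -> R}).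

Local Open Scope ring_scope.

Definition supp l : {set J} := [set v | l v != 0]%SET.

(** Coordinates are nonnegative on the simplex, so [l v <= 0] amounts to [l v = 0]. *)
Lemma Q_supp S l : simplex l -> Q S l <-> supp l \subset S.
Proof.
move=> sl; split=> [[[l0 _] lS]|sub].
  apply/fintype.subsetP => v; rewrite inE; apply: contraNT => /lS lv.
  by rewrite eq_le lv l0.
split=> // v; apply: contraNle => lv; apply: (fintype.subsetP sub).
by rewrite inE gt_eqF.
Qed.

Lemma CDC_supp F l : simplex l -> CDC F l <-> feasible F (supp l).
Proof.
move=> sl; split=> [[S SF /(Q_supp _ sl) sub]|].
  by apply/existsP; exists S; rewrite SF.
by case/existsP=> S /andP[SF sub]; exists S => //; apply/(Q_supp _ sl).
Qed.

Lemma supp_neq0 l : simplex l -> supp l != finset.set0.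
Proof.
move=> [_ l1]; apply/eqP => l0; have := oner_neq0 R.
rewrite -l1 big1 ?eqxx// => v _; apply/eqP; apply: contraT => lv.
by have: v \in supp l by [rewrite inE]; rewrite l0 finset.inE.
Qed.

Lemma ex_simplex_supp T :
  T != finset.set0 -> exists2 l, simplex l & supp l = T.
Proof.
rewrite -card_gt0 => T0.
have cT : #|T|%:R != 0 :> R by rewrite pnatr_eq0 -lt0n.
exists [ffun v => if v \in T then #|T|%:R^-1 else 0].
  split=> [v|]; first by rewrite ffunE; case: ifP; rewrite // invr_ge0 ler0n.
  under eq_bigr do rewrite ffunE.
  by rewrite -big_mkcond sumr_const -[LHS]mulr_natl divff.
by apply/setP => v; rewrite inE ffunE; case: ifP; rewrite ?eqxx// invr_eq0.
Qed.

End SupportSets.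

Section PairwiseSeparation.
Variable J : finType.
Implicit Types (F : {set {set J}}) (S T : {set J}).

(** The nonempty sets are exactly the supports of points of the simplex. The empty set passes the
    test on the right for any [L] and [U], yet is infeasible when [F] is empty. *)
Definition pairwise_separation F {I : finType} (L U : I -> {set J}) : Prop :=
  forall T, T != finset.set0 ->
    feasible F T <-> forall j, (T \subset L j) || (T \subset U j).

Lemma pairwise_IB_schemeP (R : realType) F (I : finType) (L U : I -> {set J}) :
  pairwise_IB_scheme R F L U <-> pairwise_separation F L U.
Proof.
split=> [sch T T0|sep].
  have [l sl sT] := ex_simplex_supp R T0.
  rewrite -sT -CDC_supp// sch; split=> [[_ h] j|h].
    by apply/orP; case: (h j Logic.I) => /(Q_supp _ sl); [left|right].
  by split=> // j _; case/orP: (h j) => /(Q_supp _ sl); [left|right].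
apply/seteqP; split=> l.
  move=> Cl; have sl : simplex l by case: Cl => S _ [].
  split=> // j _.
  have /(sep _ (supp_neq0 sl)) h : feasible F (supp l) by apply/CDC_supp.
  by case/orP: (h j) => /(Q_supp _ sl); [left|right].
move=> [sl h]; apply/CDC_supp => //; apply/sep; first exact: supp_neq0.
by move=> j; apply/orP; case: (h j Logic.I) => /(Q_supp _ sl); [left|right].
Qed.

Lemma feasible_sub F S T : S \subset T -> feasible F T -> feasible F S.
Proof.
move=> ST /existsP[V /andP[VF TV]]; apply/existsP; exists V.
by rewrite VF (fintype.subset_trans ST).
Qed.

Lemma covers_feasible1 F v : covers F -> feasible F [set v]%SET.
Proof.
move=> cov; have : v \in finset.cover F by rewrite cov inE.
case/finset.bigcupP=> S SF vS; apply/existsP; exists S.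
by rewrite SF finset.sub1set.
Qed.

(** For [u = v] both sides are false, since covering makes singletons feasible; later uses need not
    check distinctness. *)
Lemma conflict_pair F u v : covers F ->
  ([set u; v]%SET \in conflict_graph F) = ~~ feasible F [set u; v]%SET.
Proof.
move=> cov; rewrite inE cards2; have [->|] //= := eqVneq u v.
by rewrite finset.setUid covers_feasible1.
Qed.

(** A feasible [T] contains no conflict edge, so it cannot meet both sides of a biclique. The given
    scheme [L], [U] serves the converse: if [T] fails its test at [j], then points [u] outside [L j]
    and [v] outside [U j] form an infeasible pair inside [T], an edge that some biclique covers. *)
Lemma pairwise_separation_setC F (I K : finType) (L U : I -> {set J})
    (A B : K -> {set J}) :
  covers F -> pairwise_separation F L U ->
  biclique_cover (conflict_graph F) A B ->
  pairwise_separation F (fun j => ~: A j)%SET (fun j => ~: B j)%SET.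
Proof.
move=> cov sep [_ AB] T T0; split=> [fT j|h].
  apply: contraT; rewrite negb_or => /andP[].
  case/fintype.subsetPn=> a aT; rewrite inE negbK => aA.
  case/fintype.subsetPn=> b bT; rewrite inE negbK => bB.
  have : [set a; b]%SET \in conflict_graph F.
    by rewrite -AB; apply/finset.bigcupP; exists j => //; apply: imset2_f.
  rewrite conflict_pair// => /negP[]; apply: feasible_sub fT.
  by rewrite finset.subUset !finset.sub1set aT.
apply/sep => // j; apply: contraT; rewrite negb_or => /andP[].
case/fintype.subsetPn=> u uT uL /fintype.subsetPn[v vT vU].
have : [set u; v]%SET \in conflict_graph F.
  rewrite conflict_pair//; apply/negP => /sep.
  have uv0 : [set u; v]%SET != finset.set0.
    by apply/finset.set0Pn; exists u; rewrite !inE eqxx.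
  move=> /(_ uv0 j); rewrite !finset.subUset !finset.sub1set.
  by rewrite (negbTE uL) (negbTE vU) andbF.
rewrite -AB => /finset.bigcupP[k _ /imset2P[a b aA bB uvab]].
(* Only the equality of the two unordered pairs is used, so it does not matter which of [u], [v] is
   [a]. *)
have subT : [set a; b]%SET \subset T.
  by rewrite -uvab finset.subUset !finset.sub1set uT.
move: subT; rewrite finset.subUset !finset.sub1set => /andP[aT bT].
case/orP: (h k) => /fintype.subsetP sub.
  by have := sub a aT; rewrite inE aA.
by have := sub b bT; rewrite inE bB.
Qed.

Lemma biclique_cover_setC F (I : finType) (L U : I -> {set J}) :
  covers F -> pairwise_separation F L U ->
  (forall j, L j <> finset.setT /\ U j <> finset.setT) ->
  biclique_cover (conflict_graph F)
    (fun j => ~: L j)%SET (fun j => ~: U j)%SET.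
Proof.
move=> cov sep nT.
(* Feasibility of singletons gives that [L j] and [U j] together cover [J]: the complements are
   disjoint, and if one of [L j], [U j] were empty, the other would be all of [J], against [nT]. *)
have LU j v : (v \in L j) || (v \in U j).
  have v0 : [set v]%SET != finset.set0 by apply/finset.set0Pn; exists v; rewrite inE.
  have /(sep _ v0)/(_ j) := covers_feasible1 v cov.
  by rewrite !finset.sub1set.
have CT S : ((~: S)%SET == finset.set0) = (S == finset.setT).
  by rewrite -finset.setCT (inj_eq (@finset.setC_inj J)).
have C0 S : ((~: S)%SET == finset.setT) = (S == finset.set0).
  by rewrite -finset.setC0 (inj_eq (@finset.setC_inj J)).
split=> [j|].
  have [/eqP LT /eqP UT] := nT j.
  rewrite !finset.proper0 !finset.properT !CT !C0 LT UT; split=> //.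
  - apply: contraNneq UT => L0; apply/eqP/setP => v.
    by have := LU j v; rewrite L0 !inE.
  - apply: contraNneq LT => U0; apply/eqP/setP => v.
    by have := LU j v; rewrite U0 !inE orbF.
  - by apply/setP => v; rewrite !inE -negb_or LU.
apply/setP => e; apply/finset.bigcupP/idP => [[j _ /imset2P[a b]]|].
  rewrite !finset.in_setC => aL bU ->; rewrite conflict_pair//.
  have ab0 : [set a; b]%SET != finset.set0.
    by apply/finset.set0Pn; exists a; rewrite !inE eqxx.
  apply/negP => /(sep _ ab0)/(_ j); rewrite !finset.subUset !finset.sub1set.
  by rewrite (negbTE aL) (negbTE bU) andbF.
rewrite inE => /andP[/cards2P[u [v [_ ->]]] nf].
have uv0 : [set u; v]%SET != finset.set0.
  by apply/finset.set0Pn; exists u; rewrite !inE eqxx.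
have /existsP[j] : [exists j, ~~ (([set u; v]%SET \subset L j)
                               || ([set u; v]%SET \subset U j))].
  by apply: contraR nf => /existsPn h; apply/sep => // j; rewrite -[_ || _]negbK.
rewrite negb_or !finset.subUset !finset.sub1set !negb_and => /andP[uvL uvU].
exists j => //.
have := LU j u; have := LU j v.
(* By [LU] no vertex lies outside both [L j] and [U j], which leaves the two orientations of the
   edge. *)
case/orP: uvL => nL; case/orP: uvU => nU;
  rewrite ?(negbTE nL) ?(negbTE nU) ?orbF //= => _ _.
- by apply: imset2_f; rewrite inE.
- by rewrite finset.setUC; apply: imset2_f; rewrite inE.
Qed.

Lemma pairwise_separation_nontrivial F (I : finType) (L U : I -> {set J}) :
  pairwise_separation F L U ->
  pairwise_separation F
    (fun k : {j : I | (L j != finset.setT) && (U j != finset.setT)} => L (val k))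
    (fun k => U (val k)).
Proof.
move=> sep T T0; split=> [/(sep _ T0) h k|h]; first exact: h.
apply/sep => // j.
have [nT|] := boolP ((L j != finset.setT) && (U j != finset.setT)).
  exact: (h (exist _ j nT)).
by rewrite negb_and !negbK => /orP[] /eqP->; rewrite finset.subsetT ?orbT.
Qed.

End PairwiseSeparation.

(** If [L j] or [U j] is all of [J], its complement is an empty side, which [biclique_cover]
    forbids. The converse is therefore given in two forms: for schemes without such indices, and for
    any scheme after discarding them. *)
Theorem theorem3 (R : realType) (J : finType) (F : {set {set J}})
    (hirr : irredundant F) (hcov : covers F) :
  (pairwise_IB_representable R F ->
   forall (t : nat) (A B : 'I_t -> {set J}),
     biclique_cover (conflict_graph F) A B ->
     pairwise_IB_scheme R F (fun j => ~: A j)%SET (fun j => ~: B j)%SET)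
  /\
  (forall (t : nat) (L U : 'I_t -> {set J}),
     pairwise_IB_scheme R F L U ->
     ((forall j, L j <> finset.setT /\ U j <> finset.setT) ->
      biclique_cover (conflict_graph F)
        (fun j => ~: L j)%SET (fun j => ~: U j)%SET)
     /\
     biclique_cover (conflict_graph F)
       (fun k : {j : 'I_t | (L j != finset.setT) && (U j != finset.setT)} =>
          ~: L (val k))%SET
       (fun k : {j : 'I_t | (L j != finset.setT) && (U j != finset.setT)} =>
          ~: U (val k))%SET).
Proof.
split=> [[s [L [U /pairwise_IB_schemeP sep]]] t A B AB|t L U].
  exact/pairwise_IB_schemeP/(pairwise_separation_setC hcov sep AB).
move=> /pairwise_IB_schemeP sep; split; first exact: biclique_cover_setC.
apply: biclique_cover_setC (pairwise_separation_nontrivial sep) _ => //.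
by move=> [j /= /andP[/eqP LT /eqP UT]].
Qed.
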